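(* Let $\mathbf G$ be a split semisimple group and $Q$ a Weyl-invariant integer-valued quadratic form on its cocharacter lattice $Y$. Then the following holds. (i) For every semisimple $\mathbf G$ one has $b_{W,n}\le|\pi_1(\overline G_{Q,n}^\vee)|$. (ii) If $\mathbf G$ is simply-connected, then $b_{W,n}\le1$ for all $n$. (iii) If $\rho\in Y$, then for every $n$ such that $X\subset X_{Q,n}^{sc}$ we have $b_{W,n}=|\pi_1(\overline G_{Q,n}^\vee)|$. In particular, if $\mathbf G$ is of adjoint type, then $b_{W,n}=|\pi_1(\overline G_{Q,n}^\vee)|$ for every $n$.
   Context: $(X,\Phi,\Delta;Y,\Phi^\vee,\Delta^\vee)$ is the root datum of $\mathbf G$, $W$ its Weyl group. $B_Q(x,y)=Q(x+y)-Q(x)-Q(y)$. For $n\ge1$: $Y_{Q,n}=\{y\in Y:B_Q(y,y')\in n\mathbf Z\ \forall y'\in Y\}$, $n_\alpha=n/\gcd(n,Q(\alpha^\vee))$, $\alpha_{Q,n}^\vee=n_\alpha\alpha^\vee$, $\alpha_{Q,n}=\alpha/n_\alpha\in X\otimes\mathbf Q$; $Y_{Q,n}^{sc}\subset Y$ is the lattice spanned by all $\alpha_{Q,n}^\vee$ and $X_{Q,n}^{sc}\subset X\otimes\mathbf Q$ the lattice spanned by all $\alpha_{Q,n}$. $\rho=\frac12\sum_{\alpha>0}\alpha^\vee$. $W$ acts on $Y$ by $w[y]=w(y-\rho)+\rho$, which descends to $\mathscr X_{Q,n}=Y/Y_{Q,n}$; $b_{W,n}=|(\mathscr X_{Q,n})^W|$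 is the number of points fixed by this twisted action. The dual group $\overline G_{Q,n}^\vee$ is the split reductive group with root datum $(Y_{Q,n},\{\alpha_{Q,n}^\vee\};\mathrm{Hom}(Y_{Q,n},\mathbf Z),\{\alpha_{Q,n}\})$ (character lattice $Y_{Q,n}$, roots $\alpha_{Q,n}^\vee$), and its algebraic fundamental group satisfies $\pi_1(\overline G_{Q,n}^\vee)\simeq P(Y_{Q,n}^{sc})/Y_{Q,n}$, where $P(Y_{Q,n}^{sc})\subset Y\otimes\mathbf Q$ is the dual lattice of $X_{Q,n}^{sc}$ under $\langle-,-\rangle$. *)

(* Defs.v *)
From HB Require Import structures.
From mathcomp Require Import all_boot all_order all_algebra.
From mathcomp Require Import finmap.
From mathcomp Require Import boolp classical_sets functions cardinality.

Set Implicit Arguments.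
Unset Strict Implicit.
Unset Printing Implicit Defensive.

Import Order.TTheory GRing.Theory Num.Theory.
Local Open Scope classical_set_scope.
Local Open Scope ring_scope.

(* Both X (x) Q and Y (x) Q are 'rV[rat]_r, put in duality by the dot product;
   X, Y and the other lattices are subsets of this space. *)

Definition pairing (r : nat) (x y : 'rV[rat]_r) : rat := (x *m y^T) 0 0.

Definition zspan (r : nat) (I : finType) (f : I -> 'rV[rat]_r) :
    set 'rV[rat]_r :=
  [set v | exists c : I -> int, v = \sum_i f i *~ c i].

Definition is_lattice (r : nat) (L : set 'rV[rat]_r) : Prop :=
  exists2 e : 'M[rat]_r, e \in unitmx & L = zspan (fun i => row i e).

(* For a lattice L of full rank, this is Hom(L, Z). *)
Definition dual_lattice (r : nat) (L : set 'rV[rat]_r) : set 'rV[rat]_r :=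
  [set v | forall u, L u -> pairing u v \is a Num.int].

Definition coset (r : nat) (L : set 'rV[rat]_r) (v : 'rV[rat]_r) :
    set 'rV[rat]_r :=
  [set v + l | l in L].

Definition quotient (r : nat) (M L : set 'rV[rat]_r) : set (set 'rV[rat]_r) :=
  [set coset L v | v in M].

(* This is 0 on infinite sets, but it is only applied to finite ones, by
   finite_quotient_YQn and finite_pi1 below. *)
Definition card_set (T : choiceType) (A : set T) : nat := #|` fset_set A|.

(* The bijection between roots and coroots is given by a common indexing. *)
Record root_data (r : nat) := RootData {
  root_index : finType;
  charlat : set 'rV[rat]_r;
  cocharlat : set 'rV[rat]_r;
  rootv : root_index -> 'rV[rat]_r;
  corootv : root_index -> 'rV[rat]_r;
  simple : {set root_index}
}.

Definition positive_root (r : nat) (D : root_data r) (i : root_index D) : Prop :=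
  exists c : root_index D -> nat,
    rootv i = \sum_(j in simple D) rootv j *+ c j.

Definition refl (r : nat) (D : root_data r) (i : root_index D)
    (x : 'rV[rat]_r) : 'rV[rat]_r :=
  x - pairing x (corootv i) *: rootv i.

Definition corefl (r : nat) (D : root_data r) (i : root_index D)
    (y : 'rV[rat]_r) : 'rV[rat]_r :=
  y - pairing (rootv i) y *: corootv i.

(* Reduced based root datum. *)
Record is_root_datum (r : nat) (D : root_data r) : Prop := IsRootDatum {
  charlat_lattice : is_lattice (charlat D);
  cocharlat_dual : cocharlat D = dual_lattice (charlat D);
  root_charlat : forall i : root_index D, charlat D (rootv i);
  coroot_cocharlat : forall i : root_index D, cocharlat D (corootv i);
  root_inj : injective (@rootv r D);
  coroot_inj : injective (@corootv r D);
  pairing_root_coroot :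
    forall i : root_index D, pairing (rootv i) (corootv i) = 2;
  refl_root : forall i j : root_index D,
    exists k : root_index D, refl i (rootv j) = rootv k;
  corefl_coroot : forall i j : root_index D,
    exists k : root_index D, corefl i (corootv j) = corootv k;
  root_reduced : forall (i j : root_index D) (c : rat),
    rootv j = c *: rootv i -> rootv j = rootv i \/ rootv j = - rootv i;
  simple_free : forall c : root_index D -> rat,
    \sum_(i in simple D) c i *: rootv i = 0 ->
    forall i, i \in simple D -> c i = 0;
  simple_base : forall i : root_index D, positive_root i \/
    exists2 j : root_index D, positive_root j & rootv i = - rootv j
}.

Definition semisimple (r : nat) (D : root_data r) : Prop :=
  forall v : 'rV[rat]_r, exists c : root_index D -> rat,
    v = \sum_i c i *: rootv i.

Definition simply_connected (r : nat) (D : root_data r) : Prop :=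
  cocharlat D = zspan (@corootv r D).

Definition adjoint_type (r : nat) (D : root_data r) : Prop :=
  charlat D = zspan (@rootv r D).

(* Algebraic fundamental group: cocharacter lattice modulo coroot lattice. *)
Definition pi1 (r : nat) (D : root_data r) : set (set 'rV[rat]_r) :=
  quotient (cocharlat D) (zspan (@corootv r D)).

(* The Weyl group, through its action on Y (x) Q; the reflections are
   involutions, so the products of reflections form a group. *)
Inductive weyl (r : nat) (D : root_data r) :
    ('rV[rat]_r -> 'rV[rat]_r) -> Prop :=
| weyl_id : weyl D id
| weyl_refl (i : root_index D) w : weyl D w -> weyl D (corefl i \o w).

Definition rho (r : nat) (D : root_data r) : 'rV[rat]_r :=
  2^-1 *: \sum_(i : root_index D | `[< positive_root i >]) corootv i.

Definition twisted (r : nat) (D : root_data r)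
    (w : 'rV[rat]_r -> 'rV[rat]_r) (y : 'rV[rat]_r) : 'rV[rat]_r :=
  w (y - rho D) + rho D.

Definition polar (r : nat) (Q : 'rV[rat]_r -> int) (x y : 'rV[rat]_r) : int :=
  Q (x + y) - Q x - Q y.

(* Integer-valued quadratic forms on Y are functions on Y (x) Q of which only
   the restriction to Y is ever used. *)
Record is_quadratic_form (r : nat) (Y : set 'rV[rat]_r)
    (Q : 'rV[rat]_r -> int) : Prop := IsQuadraticForm {
  quadZ : forall (a : int) y, Y y -> Q (y *~ a) = a ^+ 2 * Q y;
  polarDl : forall x y z, Y x -> Y y -> Y z ->
    polar Q (x + y) z = polar Q x z + polar Q y z
}.

Definition weyl_invariant (r : nat) (D : root_data r)
    (Q : 'rV[rat]_r -> int) : Prop :=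
  forall w y, weyl D w -> cocharlat D y -> Q (w y) = Q y.

Section Covering.
Variables (r : nat) (D : root_data r) (Q : 'rV[rat]_r -> int) (n : nat).

Definition YQn : set 'rV[rat]_r :=
  [set y | cocharlat D y /\
     forall y', cocharlat D y' -> (n%:Z %| polar Q y y')%Z].

Definition n_root (i : root_index D) : nat :=
  (n %/ gcdn n `|Q (corootv i)|)%N.

Definition corootQn (i : root_index D) : 'rV[rat]_r := corootv i *+ n_root i.

Definition rootQn (i : root_index D) : 'rV[rat]_r :=
  (n_root i)%:R^-1 *: rootv i.

Definition XQn_sc : set 'rV[rat]_r := zspan rootQn.

(* Root datum of the dual group of the covering: its roots are the corootQn i
   and its coroots are the rootQn i. *)
Definition dual_group : root_data r :=
  @RootData r (root_index D) YQn (dual_lattice YQn) corootQn rootQn (simple D).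

(* Points of Y / Y_{Q,n} fixed by the twisted action of W. *)
Definition fixedQn : set (set 'rV[rat]_r) :=
  [set C | quotient (cocharlat D) YQn C /\
     forall w, weyl D w -> [set twisted D w y | y in C] = C].

Definition b_W : nat := card_set fixedQn.

End Covering.

Lemma pairingC (r : nat) (x y : 'rV[rat]_r) : pairing x y = pairing y x.
Proof. by rewrite /pairing -[in LHS](trmxK x) -trmx_mul [LHS]mxE. Qed.

Lemma pairingZr (r : nat) (a : rat) (x y : 'rV[rat]_r) :
  pairing x (a *: y) = a * pairing x y.
Proof. by rewrite /pairing linearZ /= -scalemxAr mxE. Qed.

Lemma pairing_sumr (r : nat) (I : finType) (x : 'rV[rat]_r)
    (f : I -> 'rV[rat]_r) : pairing x (\sum_i f i) = \sum_i pairing x (f i).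
Proof. by rewrite /pairing linear_sum /= mulmx_sumr summxE. Qed.

Lemma dual_latticeP (r : nat) (e : 'M[rat]_r) : e \in unitmx ->
  dual_lattice (zspan (fun i => row i e)) = zspan (fun i => row i (invmx e)^T).
Proof.
move=> eU; apply/seteqP; split => v /=.
  move=> Lv; have vE : v = (e *m v^T)^T *m (invmx e)^T.
    by rewrite -trmx_mul mulKmx // trmxK.
  exists (fun i => Num.floor ((e *m v^T) i 0)).
  rewrite [LHS]vE mulmx_sum_row; apply: eq_bigr => i _.
  rewrite -scaler_int; congr (_ *: _); rewrite mxE floorK //.
  have -> : (e *m v^T) i 0 = pairing (row i e) v by rewrite /pairing -row_mul [RHS]mxE.
  apply: Lv; rewrite /zspan /=; exists (fun j => (j == i)%:Z).
  rewrite (bigD1 i) //= eqxx big1 ?addr0 // => j /negPf ->.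
  by rewrite mulr0z.
move=> [c ->] u [d ->]; rewrite pairing_sumr rpred_sum // => i _.
rewrite -scaler_int pairingZr rpredM ?rpred_int //.
rewrite pairingC pairing_sumr rpred_sum // => j _.
rewrite -scaler_int pairingZr rpredM ?rpred_int // pairingC.
have -> : pairing (row j e) (row i (invmx e)^T) = (1%:M : 'M[rat]_r) j i.
  rewrite -(mulmxV eU) /pairing !mxE; apply: eq_bigr => k _.
  by rewrite !mxE.
by rewrite mxE rpredMn.
Qed.

Lemma dual_latticeK (r : nat) (L : set 'rV[rat]_r) : is_lattice L ->
  dual_lattice (dual_lattice L) = L.
Proof.
move=> [e eU ->]; rewrite dual_latticeP // dual_latticeP ?unitmx_tr ?unitmx_inv //.
by rewrite -trmx_inv invmxK trmxK.
Qed.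

Lemma finite_quotient (r : nat) (M L : set 'rV[rat]_r) (I : finType)
    (e : I -> 'rV[rat]_r) (m : nat) :
  (0 < m)%N -> M `<=` zspan e -> L 0 -> (forall u v, L u -> L v -> L (u - v)) ->
  (forall i, L (e i *+ m)) -> finite_set (quotient M L).
Proof.
move=> m0 Me L0 LB Le.
have LN u : L u -> L (- u) by move=> Lu; rewrite -sub0r; apply: LB.
have LD u v : L u -> L v -> L (u + v).
  by move=> Lu Lv; rewrite -[v]opprK; apply: LB => //; apply: LN.
have LZ u (k : int) : L u -> L (u *~ k).
  move=> Lu; have LMn p : L (u *+ p).
    by elim: p => [|p IH]; rewrite ?mulr0n // mulrS; apply: LD.
  by case: k => p; [rewrite -pmulrn|rewrite NegzE mulrNz -pmulrn; apply: LN].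
have LS (f : I -> 'rV[rat]_r) : (forall i, L (f i)) -> L (\sum_i f i).
  by move=> Lf; elim/big_ind: _.
pose F (g : {ffun I -> 'I_m}) := coset L (\sum_i e i *+ g i).
apply: (@sub_finite_set _ _ (range F)); last first.
  by apply: finite_image; apply: finite_finset.
move=> C [v /Me [c vE] <-].
have lt i : (`|(c i %% m)%Z|%N < m)%N.
  by rewrite -ltz_nat gez0_abs ?modz_ge0 ?ltz_pmod // -?lt0n // gt_eqF.
exists [ffun i => Ordinal (lt i)] => //.
rewrite /F; set s := \sum_i _.
have Lvs : L (v - s).
  rewrite vE /s -sumrB; apply: LS => i; rewrite ffunE /=.
  have -> : e i *~ c i - e i *+ `|(c i %% m)%Z|%N = e i *+ m *~ (c i %/ m)%Z.
    rewrite [X in _ *~ X - _](divz_eq (c i) m) pmulrn.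
    rewrite gez0_abs ?modz_ge0 -?lt0n // ?gt_eqF //.
    by rewrite mulrzDr addrK mulrC mulrzA -pmulrn.
  exact: LZ.
apply/seteqP; split => x [l Ll <-].
  exists (l - (v - s)); first exact: LB.
  by rewrite opprB [l + _]addrC addrA subrKC.
by exists (v - s + l); [exact: LD|rewrite addrA subrKC].
Qed.

Section Finiteness.
Variables (r : nat) (D : root_data r) (Q : 'rV[rat]_r -> int) (n : nat).
Hypotheses (hD : is_root_datum D) (n0 : (0 < n)%N).
Hypothesis hQ : is_quadratic_form (cocharlat D) Q.

Let YB u v : cocharlat D u -> cocharlat D v -> cocharlat D (u - v).
Proof.
rewrite (cocharlat_dual hD) => Yu Yv x Xx.
by rewrite -scaleN1r /pairing linearD mulmxDr mxE rpredD //;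
  rewrite -/(pairing _ _) ?pairingZr ?rpredM ?Yu ?Yv.
Qed.

Let Y0 : cocharlat D 0.
Proof. by rewrite (cocharlat_dual hD) => x _; rewrite /pairing trmx0 mulmx0 mxE. Qed.

Let YMn u k : cocharlat D u -> cocharlat D (u *+ k).
Proof.
move=> Yu; elim: k => [//|k IH].
by rewrite mulrS -[u *+ k]opprK; apply: YB => //; rewrite -sub0r; apply: YB.
Qed.

Let polar0 y : cocharlat D y -> polar Q 0 y = 0.
Proof.
move=> Yy; have := polarDl hQ Y0 Y0 Yy; rewrite addr0.
by rewrite -{1}[polar Q 0 y]addr0 => /addrI <-.
Qed.

Let polarMn u k y : cocharlat D u -> cocharlat D y ->
  polar Q (u *+ k) y = polar Q u y *+ k.
Proof.
move=> Yu Yy; elim: k => [|k IH]; first by rewrite !mulr0n polar0.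
by rewrite !mulrS (polarDl hQ) ?IH //; apply: YMn.
Qed.

Lemma YQn_mul y : cocharlat D y -> YQn D Q n (y *+ n).
Proof.
move=> Yy; split; first exact: YMn.
by move=> y' Yy'; rewrite polarMn // -mulr_natr natz dvdz_mull.
Qed.

Lemma finite_quotient_YQn : finite_set (quotient (cocharlat D) (YQn D Q n)).
Proof.
have [e eU XE] := charlat_lattice hD.
have YE : cocharlat D = zspan (fun i => row i (invmx e)^T).
  by rewrite (cocharlat_dual hD) XE dual_latticeP.
apply: (@finite_quotient _ _ _ _ (fun i => row i (invmx e)^T) n) => //.
- by rewrite YE.
- by split => // y Yy; rewrite polar0 // dvdz0.
- move=> u v [Yu hu] [Yv hv]; split; first exact: YB.
  move=> y Yy; have := polarDl hQ (YB Yu Yv) Yv Yy; rewrite subrK => E.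
  have -> : polar Q (u - v) y = polar Q u y - polar Q v y by rewrite E addrK.
  by rewrite rpredB //; [exact: hu|exact: hv].
- move=> i; apply: YQn_mul; rewrite YE; exists (fun j => (j == i)%:Z).
  rewrite (bigD1 i) //= eqxx big1 ?addr0 // => j /negPf ->.
  by rewrite mulr0z.
Qed.

Lemma finite_fixedQn : finite_set (fixedQn D Q n).
Proof. by apply: sub_finite_set finite_quotient_YQn => C []. Qed.

Lemma finite_pi1 : semisimple D -> finite_set (pi1 (dual_group D Q n)).
Proof.
move=> hss; have [e eU XE] := charlat_lattice hD.
have n0' : (n%:R : rat) != 0 by rewrite pnatr_eq0 -lt0n.
have nr0 i : ((n_root Q n i)%:R : rat) != 0.
  rewrite pnatr_eq0 -lt0n divn_gt0 ?gcdn_gt0 ?n0 //.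
  by apply: dvdn_leq => //; apply: dvdn_gcdl.
have [c cE] : exists c : 'I_r -> root_index D -> rat,
    forall i, n%:R^-1 *: row i e = \sum_j c i j *: rootQn Q n j.
  have [c cE] := choice (fun i : 'I_r => hss (n%:R^-1 *: row i e)).
  exists (fun i j => c i j * (n_root Q n j)%:R) => i.
  by rewrite cE; apply: eq_bigr => j _; rewrite /rootQn scalerA mulfK.
pose m := (\prod_(p : 'I_r * root_index D) `|denq (c p.1 p.2)|)%N.
apply: (@finite_quotient _ _ _ _ (fun i => n%:R^-1 *: row i e) m).
- by rewrite prodn_gt0 // => p; rewrite absz_gt0 denq_neq0.
- move=> x xY; have : charlat D (n%:R *: x).
    rewrite -(dual_latticeK (charlat_lattice hD)) -(cocharlat_dual hD) => y Yy.
    rewrite pairingZr pairingC -pairingZr scaler_nat pairingC.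
    exact: xY (YQn_mul Yy).
  rewrite XE => -[d dE]; exists d; rewrite -[x](scalerK n0') dE scaler_sumr.
  by apply: eq_bigr => i _; rewrite -!scaler_int !scalerA mulrC.
- by exists (fun=> 0); rewrite big1 // => i _; rewrite mulr0z.
- move=> u v [a ->] [b ->]; exists (fun i => a i - b i).
  by rewrite -sumrB; apply: eq_bigr => i _; rewrite mulrzBr.
- move=> i; rewrite cE -sumrMnl.
  have cZ j : c i j *+ m \is a Num.int.
    rewrite /m (bigD1 (i, j)) //= mulrnA -mulr_natr rpredM ?natr_int //.
    rewrite -{1}[c i j]divq_num_den -mulr_natr natr_absz gtr0_norm ?denq_gt0 //.
    by rewrite mulfVK ?rpred_int // intr_eq0 denq_neq0.
  exists (fun j => Num.floor (c i j *+ m)); apply: eq_bigr => j _ /=.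
  by rewrite -[RHS]scaler_int floorK // scalerMnl.
Qed.

End Finiteness.

(* Main.v *)
Require Import Defs.
From HB Require Import structures.
From mathcomp Require Import all_boot all_order all_algebra.
From mathcomp Require Import finmap zify.
From mathcomp Require Import boolp classical_sets functions cardinality.

(** Write [<,>] for the pairing, [B] for the polar form of [Q], [a] for a root with
    coroot [a'], and [n_a] for its [n_root].

    Invariance of [Q] under the reflection of [a] gives [B(a', y) = Q(a') <a, y>]
    ([polar_coroot]), so that [n] divides [k B(a', y)] if and only if [n_a] divides
    [k <a, y>]. The twisted reflection moves [y] by [- <a, y - rho> a'], and the
    class of [y] is fixed if and only if these multiples of coroots lie in [YQn]
    ([fixedQnP]).

    Let [P] be the dual lattice of [XQn_sc], which consists of the [v] such that
    [n_a] divides [<a, v>] for all [a]. The key point is that two fixed points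
    differ by an element of [P] ([fixed_sub]). If [a] takes an odd value on the
    cocharacter lattice, fixedness means that [n_a] divides [<a, y - rho>], and the
    claim is clear. Otherwise only [2 <a, y - rho>] has to be divisible by [n_a];
    but then [<a, rho>] is odd ([pairing_rho_odd]), which excludes that [n_a] is
    divisible by 4 and fixes the parities that matter ([dvdz_sub_odd]). The oddness
    comes from pairing off the positive roots made negative by the reflection of
    [a] ([pairing_rho_pos]).

    Therefore the fixed points are either empty or a subset of a translate of
    [P / YQn]. The fundamental group of the dual group is the quotient of the dual
    of [YQn] by [XQn_sc]; Smith normal form shows that a finite quotient of
    lattices and the quotient of the dual lattices have the same cardinality
    ([card_quotient_dual]), so it has as many elements as [P / YQn]. This is (i).

    When the coroots generate the cocharacter lattice, an element of [P] that lies
    in this lattice already lies in [YQn], whence (ii). When [rho] is a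
    cocharacter, its class is fixed and so are its translates by [P], provided
    that [P] consists of cocharacters, which is what the hypothesis of (iii) says
    by duality. For adjoint type, [rho] is a cocharacter because its pairing with
    every root is an integer, and [XQn_sc] contains all roots. *)

Set Implicit Arguments.
Unset Strict Implicit.
Unset Printing Implicit Defensive.

Import Order.TTheory GRing.Theory Num.Theory.
Local Open Scope classical_set_scope.
Local Open Scope ring_scope.

(** * The pairing and subgroups of a rational vector space *)

Section Pairing.
Variables (r : nat) (x : 'rV[rat]_r).

Fact pairing_is_scalar : scalar (pairing x).
Proof.
by move=> a u v; rewrite /pairing linearP mulmxDr -scalemxAr mxE [X in X + _]mxE.
Qed.

HB.instance Definition _ :=
  GRing.isLinear.Build rat 'rV[rat]_r rat *%R (pairing x) pairing_is_scalar.

End Pairing.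

Section PairingTheory.
Variables (r : nat).
Implicit Types x y z : 'rV[rat]_r.

Lemma pairingDr x y z : pairing x (y + z) = pairing x y + pairing x z.
Proof. exact: linearD. Qed.

Lemma pairingNr x y : pairing x (- y) = - pairing x y.
Proof. exact: linearN. Qed.

Lemma pairingBr x y z : pairing x (y - z) = pairing x y - pairing x z.
Proof. exact: linearB. Qed.

Lemma pairingBl x y z : pairing (x - y) z = pairing x z - pairing y z.
Proof. by rewrite !(pairingC _ z) pairingBr. Qed.

Lemma pairingDl x y z : pairing (x + y) z = pairing x z + pairing y z.
Proof. by rewrite !(pairingC _ z) pairingDr. Qed.

Lemma pairingNl x y : pairing (- x) y = - pairing x y.
Proof. by rewrite !(pairingC _ y) pairingNr. Qed.

Lemma pairingZl (c : rat) x y : pairing (c *: x) y = c * pairing x y.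
Proof. by rewrite !(pairingC _ y) pairingZr. Qed.

End PairingTheory.

Definition subgroup (r : nat) (L : set 'rV[rat]_r) : Prop :=
  L 0 /\ forall u v, L u -> L v -> L (u - v).

Section Subgroup.
Variables (r : nat) (L : set 'rV[rat]_r).
Hypothesis hL : subgroup L.

Lemma subgroupN u : L u -> L (- u).
Proof. by move=> Lu; rewrite -sub0r; apply: hL.2 => //; apply: hL.1. Qed.

Lemma subgroupD u v : L u -> L v -> L (u + v).
Proof. by move=> Lu Lv; rewrite -[v]opprK; apply: hL.2 => //; apply: subgroupN. Qed.

Lemma subgroupMn u k : L u -> L (u *+ k).
Proof.
move=> Lu; elim: k => [|k IH]; first exact: hL.1.
by rewrite mulrS; apply: subgroupD.
Qed.

Lemma subgroupMz u k : L u -> L (u *~ k).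
Proof.
move=> Lu; case: k => k; first exact: subgroupMn.
by rewrite NegzE mulrNz; apply: subgroupN; apply: subgroupMn.
Qed.

Lemma subgroup_sum (I : finType) (f : I -> 'rV[rat]_r) :
  (forall i, L (f i)) -> L (\sum_i f i).
Proof.
by move=> Lf; elim/big_ind: _ => //; [exact: hL.1|exact: subgroupD].
Qed.

Lemma zspan_sub (I : finType) (f : I -> 'rV[rat]_r) :
  (forall i, L (f i)) -> zspan f `<=` L.
Proof. by move=> Lf v [c ->]; apply: subgroup_sum => i; apply: subgroupMz. Qed.

Lemma coset_eq u v : (coset L u = coset L v) <-> L (u - v).
Proof.
split=> [E|Luv].
  have : coset L u u by exists 0; rewrite ?addr0 //; exact: hL.1.
  by rewrite E => -[l Ll <-]; rewrite [v + l]addrC addrK.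
apply/seteqP; split => x [l Ll <-].
  by exists (u - v + l); [exact: subgroupD|rewrite addrA subrKC].
by exists (l - (u - v)); [exact: hL.2|rewrite opprB [l + _]addrC addrA subrKC].
Qed.

End Subgroup.

Lemma zspan_gen (r : nat) (I : finType) (f : I -> 'rV[rat]_r) i : zspan f (f i).
Proof.
exists (fun j => (j == i)%:Z).
by rewrite (bigD1 i) //= eqxx big1 ?addr0 // => j /negPf ->; rewrite mulr0z.
Qed.

Lemma zspan_subgroup (r : nat) (I : finType) (f : I -> 'rV[rat]_r) :
  subgroup (zspan f).
Proof.
split; first by exists (fun=> 0); rewrite big1 // => i _; rewrite mulr0z.
move=> u v [a ->] [b ->]; exists (fun i => a i - b i).
by rewrite -sumrB; apply: eq_bigr => i _; rewrite mulrzBr.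
Qed.

Lemma dual_lattice_subgroup (r : nat) (L : set 'rV[rat]_r) :
  subgroup (dual_lattice L).
Proof.
split=> [x _|u v Lu Lv x Lx]; first by rewrite linear0.
by rewrite linearB rpredB //; [exact: Lu|exact: Lv].
Qed.

Lemma dual_lattice_zspan (r : nat) (I : finType) (f : I -> 'rV[rat]_r) v :
  (forall i, pairing (f i) v \is a Num.int) -> dual_lattice (zspan f) v.
Proof.
move=> fv u [c ->]; rewrite pairingC linear_sum rpred_sum // => i _.
by rewrite raddfMz -mulrzr rpredM ?rpred_int //= pairingC.
Qed.

Lemma is_lattice_dual (r : nat) (L : set 'rV[rat]_r) :
  is_lattice L -> is_lattice (dual_lattice L).
Proof.
move=> [e eU ->]; exists (invmx e)^T; first by rewrite unitmx_tr unitmx_inv.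
exact: dual_latticeP.
Qed.

Lemma pairing_eq0 (r : nat) (v : 'rV[rat]_r) :
  (forall x, pairing x v = 0) -> v = 0.
Proof.
move=> v0; apply/rowP => j; have := v0 (delta_mx 0 j).
by rewrite /pairing -rowE !mxE.
Qed.

(** * Adapted bases of lattices *)

Lemma zspan_rowsP (r m : nat) (A : 'M[rat]_(m, r)) v :
  zspan (fun i => row i A) v <->
  exists c : 'rV[int]_m, v = map_mx (intmul 1) c *m A.
Proof.
split=> -[c ->].
  exists (\row_i c i); rewrite mulmx_sum_row; apply: eq_bigr => i _.
  by rewrite !mxE scaler_int.
exists (fun i => c 0 i); rewrite mulmx_sum_row; apply: eq_bigr => i _.
by rewrite !mxE scaler_int.
Qed.

Lemma zspan_rows_mulr (r m : nat) (A : 'M[rat]_(m, r)) (T : 'M[rat]_r) :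
  [set v *m T | v in zspan (fun i => row i A)] =
  zspan (fun i => row i (A *m T)).
Proof.
apply/seteqP; split=> v /=.
  by move=> [_ /zspan_rowsP[c ->] <-]; apply/zspan_rowsP; exists c; rewrite mulmxA.
move=> /zspan_rowsP[c ->]; exists (map_mx (intmul 1) c *m A).
  by apply/zspan_rowsP; exists c.
by rewrite mulmxA.
Qed.

Lemma zspan_rows_unimodular (r m : nat) (U : 'M[int]_m) (A : 'M[rat]_(m, r)) :
  U \in unitmx ->
  zspan (fun i => row i (map_mx (intmul 1) U *m A)) = zspan (fun i => row i A).
Proof.
move=> UU; apply/seteqP; split=> v /zspan_rowsP[c ->]; apply/zspan_rowsP.
  by exists (c *m U); rewrite map_mxM mulmxA.
by exists (c *m invmx U); rewrite mulmxA -map_mxM mulmxKV.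
Qed.

Lemma map_intr_unitmx (m : nat) (U : 'M[int]_m) :
  U \in unitmx -> map_mx (intmul 1 : int -> rat) U \in unitmx.
Proof.
move=> UU; suff /mulmx1_unit[] : map_mx (intmul 1 : int -> rat) U *m
  map_mx (intmul 1) (invmx U) = 1%:M by [].
by rewrite -map_mxM mulmxV // map_mx1.
Qed.

Lemma zspan_rows_enum (r : nat) (I : finType) (f : I -> 'rV[rat]_r) :
  zspan (fun i => row i (\matrix_(i < #|I|) f (enum_val i))) = zspan f.
Proof.
apply/seteqP; split=> v [c ->].
  exists (fun i => c (enum_rank i)).
  rewrite [RHS](reindex_onto enum_val enum_rank) /=.
    by apply: eq_big => i; rewrite enum_valK ?eqxx // rowK.
  by move=> i _; rewrite enum_rankK.
exists (fun i => c (enum_val i)); rewrite [LHS](reindex_onto enum_val enum_rank) /=.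
  by apply: eq_big => i; rewrite enum_valK ?eqxx // rowK.
by move=> i _; rewrite enum_rankK.
Qed.

(** The Smith normal form of the coordinate matrix of [f] in the basis [e]: as [f]
    spans the whole space, the [r] diagonal entries are all nonzero, so a single
    basis [e'] of the big lattice turns into a basis of the span of [f] when its
    vectors are rescaled. *)
Lemma adapted_basis (r : nat) (e : 'M[rat]_r) (I : finType)
    (f : I -> 'rV[rat]_r) :
  e \in unitmx -> (forall i, zspan (fun j => row j e) (f i)) ->
  (forall v, exists c : I -> rat, v = \sum_i c i *: f i) ->
  exists (e' : 'M[rat]_r) (d : 'rV[rat]_r),
    [/\ e' \in unitmx, zspan (fun j => row j e') = zspan (fun j => row j e),
        diag_mx d \in unitmx &
        zspan f = zspan (fun j => row j (diag_mx d *m e'))].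
Proof.
move=> eU fe fspan.
set F := \matrix_(i < #|I|) f (enum_val i).
have [C CE] : exists C : 'M[int]_(#|I|, r), F = map_mx (intmul 1) C *m e.
  have fe' (i : 'I_#|I|) : exists c : 'rV[int]_r,
      f (enum_val i) = map_mx (intmul 1) c *m e by apply/zspan_rowsP.
  have [c cE] := choice fe'.
  exists (\matrix_i c i); apply/row_matrixP => i.
  rewrite rowK cE row_mul; congr (_ *m _); apply/rowP => j.
  by rewrite !mxE.
have [L LU [R RU [d _ CLDR]]] := int_Smith_normal_form C.
set Dm := \matrix_(i, j) _ in CLDR.
pose e' := map_mx (intmul 1) R *m e.
have e'U : e' \in unitmx by rewrite unitmx_mul map_intr_unitmx.
have FE : F = map_mx (intmul 1) L *m (map_mx (intmul 1) Dm *m e').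
  by rewrite CE CLDR !map_mxM -!mulmxA.
(* Were the [j]-th diagonal entry zero or missing, no combination of the [f i]
   would have a nonzero coordinate along row [j] of [e']. *)
have dP (j : 'I_r) : (j < #|I|)%N && (d`_j != 0).
  have [c cE] := fspan (delta_mx 0 j *m e').
  have : delta_mx 0 j = (\row_i c (enum_val i)) *m map_mx (intmul 1) L
                         *m map_mx (intmul 1) Dm :> 'rV[rat]_r.
    apply: (can_inj (mulmxK e'U)); rewrite -!mulmxA -FE cE mulmx_sum_row.
    rewrite [LHS](reindex_onto enum_val enum_rank) /=.
      by apply: eq_big => i; rewrite enum_valK ?eqxx // rowK mxE.
    by move=> i _; rewrite enum_rankK.
  move=> /rowP/(_ j); rewrite mxE !eqxx [RHS]mxE; apply: contra_eqT => ndj.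
  rewrite big1 ?oner_eq0 // => i _; rewrite [X in _ * X]mxE [Dm _ _]mxE.
  case: eqP => [ij|_]; last by rewrite mulr0n mulr0z mulr0.
  by move: ndj; rewrite -ij ltn_ord /= negbK => /eqP ->; rewrite mul0rn mulr0z mulr0.
pose h j := Ordinal (proj1 (andP (dP j))).
have DE (c : 'rV[int]_#|I|) : map_mx (intmul 1) c *m map_mx (intmul 1) Dm =
    map_mx (intmul 1) (\row_j c 0 (h j)) *m diag_mx (\row_j (d`_j)%:~R)
    :> 'rV[rat]_r.
  rewrite mul_mx_diag; apply/rowP => j; rewrite !mxE (bigD1 (h j)) //= !mxE.
  rewrite eqxx mulr1n big1 ?addr0 // => i; rewrite -val_eqE /= => /negPf ij.
  by rewrite !mxE ij mulr0n mulr0.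
exists e', (\row_j (d`_j)%:~R); split=> //; first exact: zspan_rows_unimodular.
  rewrite unitmxE det_diag unitfE; apply/prodf_neq0 => j _.
  by rewrite mxE intr_eq0; case/andP: (dP j).
rewrite -zspan_rows_enum -/F FE zspan_rows_unimodular //.
apply/seteqP; split=> v /zspan_rowsP[c ->]; apply/zspan_rowsP.
  by exists (\row_j c 0 (h j)); rewrite !mulmxA DE.
exists (\row_i oapp (c 0) 0 (insub (val i))); rewrite !mulmxA DE.
congr (_ *m _ *m _ *m _); apply/rowP => j; rewrite !mxE.
by rewrite (valK j).
Qed.

(** Such an [S] is finitely generated, by [n *: M] and by those among the finitely
    many representatives of [M] modulo [n *: M] that lie in [S]; adapted bases
    then apply. *)
Lemma is_lattice_between (r : nat) (M S : set 'rV[rat]_r) (n : nat) :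
  (0 < n)%N -> is_lattice M -> subgroup S -> S `<=` M ->
  (forall y, M y -> S (y *+ n)) -> is_lattice S.
Proof.
move=> n0 [e eU ME] hS SM MnS.
pose s (p : {ffun 'I_r -> 'I_n}) := \sum_i row i e *+ p i.
pose g (x : 'I_r + {ffun 'I_r -> 'I_n}) := match x with
  | inl i => row i e *+ n
  | inr p => if `[< S (s p) >] then s p else 0 end.
have gS x : S (g x).
  case: x => [i|p] /=; first by apply: MnS; rewrite ME; apply: zspan_gen.
  by case: ifPn => [/asboolP //|_]; apply: hS.1.
have SE : S = zspan g.
  apply/seteqP; split; last exact: zspan_sub.
  move=> y Sy; have := SM _ Sy; rewrite ME => -[c yE].
  have lt i : (`|(c i %% n)%Z|%N < n)%N.
    by rewrite -ltz_nat gez0_abs ?modz_ge0 ?ltz_pmod // -?lt0n // gt_eqF.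
  pose p := [ffun i => Ordinal (lt i)].
  have yE' : y = \sum_i row i e *+ n *~ (c i %/ n)%Z + s p.
    rewrite yE /s -big_split; apply: eq_bigr => i _; rewrite ffunE /=.
    rewrite {1}(divz_eq (c i) n) [X in _ = _ + X]pmulrn.
    rewrite gez0_abs ?modz_ge0 -?lt0n // ?gt_eqF //.
    by rewrite mulrzDr mulrC mulrzA -pmulrn.
  have hz : zspan g (\sum_i row i e *+ n *~ (c i %/ n)%Z).
    apply: subgroup_sum; first exact: zspan_subgroup.
    move=> i; apply: subgroupMz; first exact: zspan_subgroup.
    exact: (zspan_gen g (inl i)).
  have Sp : S (s p).
    rewrite -[s p](addKr (\sum_i row i e *+ n *~ (c i %/ n)%Z)) -yE' addrC.
    apply: hS.2 => //; exact: zspan_sub gS _ hz.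
  rewrite yE'; apply: subgroupD => //; first exact: zspan_subgroup.
  by have := zspan_gen g (inr p); rewrite /= (asboolT Sp).
have [||e' [d [e'U _ dU gE]]] := @adapted_basis _ e _ g eU.
- by move=> x; rewrite -ME; apply: SM.
- move=> v; pose c j := (v *m invmx e) 0 j / n%:R.
  exists (fun x => if x is inl i then c i else 0).
  rewrite big_sumType /= [X in _ + X]big1 ?addr0 => [|i _]; last by rewrite scale0r.
  rewrite -{1}[v](mulmxKV eU) mulmx_sum_row; apply: eq_bigr => i _.
  rewrite -scaler_nat scalerA /c divfK // pnatr_eq0 -lt0n //.
by rewrite SE gE; exists (diag_mx d *m e'); rewrite ?unitmx_mul ?dU.
Qed.

(** * Counting the elements of quotients of lattices *)

Lemma card_set_image (T U : choiceType) (f : T -> U) (A : set T) :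
  injective f -> finite_set A -> card_set [set f x | x in A] = card_set A.
Proof. by move=> fI Af; rewrite /card_set fset_set_image // card_imfset. Qed.

Lemma card_set_sub (T : choiceType) (A B : set T) :
  finite_set B -> A `<=` B -> (card_set A <= card_set B)%N.
Proof.
move=> Bf AB; have Af := sub_finite_set AB Bf.
by rewrite fsubset_leq_card // -fset_set_sub.
Qed.

Lemma image_set_inj (T U : Type) (f : T -> U) :
  injective f -> injective (fun A : set T => [set f x | x in A]).
Proof.
move=> fI A B AB; apply/seteqP; split=> x.
  by move=> Ax; rewrite -(image_inj fI) -AB (image_inj fI).
by move=> Bx; rewrite -(image_inj fI) AB (image_inj fI).
Qed.

(** In a basis [e'] of [M] for which the rescaled basis [g] is one of the span of
    [f], the linear map sending each [e'_i] to the dual vector of [g_i] maps [M] to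
    the dual of the span and, because the rescaling is diagonal, maps the span to
    the dual of [M]. It therefore carries one quotient onto the other. *)
Lemma card_quotient_dual (r : nat) (M : set 'rV[rat]_r) (I : finType)
    (f : I -> 'rV[rat]_r) :
  is_lattice M -> (forall i, M (f i)) ->
  (forall v, exists c : I -> rat, v = \sum_i c i *: f i) ->
  finite_set (quotient M (zspan f)) ->
  finite_set (quotient (dual_lattice (zspan f)) (dual_lattice M)) /\
  card_set (quotient M (zspan f)) =
  card_set (quotient (dual_lattice (zspan f)) (dual_lattice M)).
Proof.
move=> [e eU ME] Mf fspan fin.
have [||e' [d [e'U e'E dU fE]]] := @adapted_basis _ e _ f eU => //.
  by move=> i; rewrite -ME.
set g := diag_mx d *m e' in fE.
have gU : g \in unitmx by rewrite unitmx_mul dU.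
pose T := invmx e' *m (invmx g)^T.
have TU : T \in unitmx by rewrite unitmx_mul unitmx_inv e'U unitmx_tr unitmx_inv.
have MT : dual_lattice (zspan f) = [set v *m T | v in M].
  by rewrite fE dual_latticeP // ME -e'E zspan_rows_mulr mulKVmx.
have LT : dual_lattice M = [set v *m T | v in zspan f].
  rewrite ME -e'E dual_latticeP // fE zspan_rows_mulr /T mulmxA mulmxK //.
  have -> : (invmx e')^T = diag_mx d *m (invmx g)^T; last by [].
  rewrite -[diag_mx d]tr_diag_mx -trmx_mul; congr (_^T).
  by apply: (can_inj (mulKmx gU)); rewrite mulKVmx // /g mulmxK.
have TI : injective (fun v : 'rV[rat]_r => v *m T) := can_inj (mulmxK TU).
suff -> : quotient (dual_lattice (zspan f)) (dual_lattice M) =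
    [set [set v *m T | v in C] | C in quotient M (zspan f)].
  split; first exact: finite_image.
  by rewrite (card_set_image (image_set_inj TI) fin).
rewrite MT LT /quotient [LHS]image_comp [RHS]image_comp.
apply: eq_imagel => v _ /=; rewrite /coset !image_comp.
by apply: eq_imagel => u _ /=; rewrite mulmxDl.
Qed.

Lemma coset_translate (r : nat) (L : set 'rV[rat]_r) (t y : 'rV[rat]_r) :
  [set t + x | x in coset L y] = coset L (t + y).
Proof. by rewrite /coset image_comp; apply: eq_imagel => u _ /=; rewrite addrA. Qed.

(** * Reflections, coroots and the parity of rho *)

(** Pick one element in each orbit [{x, s x}], say the one that comes first in an
    enumeration. *)
Lemma sum_fixfree_involution (V : nmodType) (T : finType) (P : pred T)
    (s : T -> T) (f : T -> V) :
  involutive s -> (forall x, P (s x) = P x) -> (forall x, P x -> s x != x) ->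
  (forall x, P x -> f (s x) = f x) ->
  exists S : {set T}, \sum_(x | P x) f x = (\sum_(x in S) f x) *+ 2.
Proof.
move=> sK Ps sx fs; pose up := [pred x | (enum_rank x < enum_rank (s x))%N].
exists [set x | P x && up x]%SET.
under [X in _ = X *+ 2]eq_bigl => x do rewrite inE.
rewrite (bigID up) /= mulr2n; congr (_ + _).
rewrite (reindex_inj (inv_inj sK)) /=; apply: eq_big => [x|x].
  rewrite Ps sK -leqNgt; apply: andb_id2l => Px.
  by rewrite leq_eqVlt val_eqE (inj_eq enum_rank_inj) [x == _]eq_sym
    (negPf (sx _ Px)).
by rewrite Ps => /andP[Px _]; apply: fs.
Qed.

Section RootDatum.
Variables (r : nat) (D : root_data r).
Hypotheses (hD : is_root_datum D) (hss : semisimple D).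

Local Notation I := (root_index D).
Implicit Types i j k l : I.
Local Notation a i := (rootv (r := r) (i : I)).
Local Notation a' i := (corootv (r := r) (i : I)).
Local Notation Y := (cocharlat D).

Lemma cocharlat_subgroup : subgroup Y.
Proof. by rewrite (cocharlat_dual hD); apply: dual_lattice_subgroup. Qed.

Lemma cocharlat_lattice : is_lattice Y.
Proof. by rewrite (cocharlat_dual hD); apply/is_lattice_dual/charlat_lattice. Qed.

Lemma pairing_root_int i y : Y y -> pairing (a i) y \is a Num.int.
Proof. by rewrite (cocharlat_dual hD); apply; apply: root_charlat. Qed.

Lemma reflK i : involutive (refl i).
Proof.
move=> x; rewrite /refl pairingBl pairingZl.
rewrite (pairing_root_coroot hD) mulr_natr mulr2n opprD.
by rewrite addNKr scaleNr opprK subrK.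
Qed.

Lemma coreflK i : involutive (corefl i).
Proof.
move=> y; rewrite /corefl pairingBr pairingZr.
rewrite (pairing_root_coroot hD) mulr_natr mulr2n opprD.
by rewrite addNKr scaleNr opprK subrK.
Qed.

Lemma pairing_refl i x y : pairing (refl i x) y = pairing x (corefl i y).
Proof.
by rewrite /refl /corefl pairingBl pairingZl pairingBr pairingZr mulrC.
Qed.

Lemma coreflD i x y : corefl i (x + y) = corefl i x + corefl i y.
Proof. by rewrite /corefl pairingDr scalerDl opprD addrACA. Qed.

Lemma refl_subZ i x y c : refl i (x - c *: y) = refl i x - c *: refl i y.
Proof.
rewrite /refl pairingBl pairingZl.
rewrite scalerBl scalerBr scalerA !opprB [X in _ + X = _]addrC addrACA.
by rewrite [X in _ + X = _]addrC.
Qed.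

Lemma refl_id i : refl i (a i) = - a i.
Proof.
by rewrite /refl (pairing_root_coroot hD) scaler_nat mulr2n opprD addNKr.
Qed.

(** The axioms only say that [corefl i (a' j)] is a coroot; it is the one of the
    reflected root because a root has a single coroot when the roots span. The
    two candidates for the coroot of [a k] differ by some [g] with
    [pairing (a k) g = 0], and both give reflections that permute the roots; their
    composite is the transvection [x + pairing x g *: a k], whose orbits on the
    finite set of roots are infinite unless [g] is orthogonal to all roots. *)
Lemma coroot_refl i j k : a k = refl i (a j) -> a' k = corefl i (a' j).
Proof.
move=> kE; apply/eqP; rewrite eq_sym -subr_eq0; apply/eqP.
set g := _ - _; apply: pairing_eq0 => x; have [c ->] := hss x.
rewrite pairingC linear_sum big1 //= => l _; rewrite pairingZr pairingC.
suff -> : pairing (a l) g = 0 by rewrite mulr0.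
pose t x := refl k (refl i (refl j (refl i x))).
have tE x0 : t x0 = x0 + pairing x0 g *: a k.
  rewrite /t [refl j _]/refl (refl_subZ i) reflK pairing_refl -kE.
  rewrite (refl_subZ k) refl_id.
  by rewrite scalerN opprK /refl [pairing x0 g]pairingBr scalerBl -addrA
    [- _ + _]addrC.
have gk : pairing (a k) g = 0.
  rewrite [LHS]pairingBr {1}kE pairing_refl coreflK !(pairing_root_coroot hD).
  by rewrite subrr.
have t_root y : (exists l, y = a l) -> exists l, t y = a l.
  have st (h : I) z : (exists l, z = a l) -> exists l, refl h z = a l.
    by move=> [l' ->]; apply: (refl_root hD).
  by move=> ly; do 4!apply: (st).
have titer m : iter m t (a l) = a l + (pairing (a l) g * m%:R) *: a k.
  elim: m => [|m IH]; first by rewrite mulr0 scale0r addr0.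
  rewrite iterS IH tE -addrA -scalerDl pairingDl pairingZl gk.
  by rewrite mulr0 addr0 -[m.+1]addn1 natrD mulrDr mulr1.
have orbit_root m : exists l', iter m t (a l) = a l'.
  by elim: m => [|m IH]; [exists l|rewrite iterS; apply: t_root].
have [h hE] := choice orbit_root.
apply/eqP; apply: contraT => gl0.
pose h' (m : 'I_#|I|.+1) := h m.
have h'I : injective h'.
  move=> m1 m2 /(congr1 (fun l => a l)); rewrite -!hE !titer => /addrI.
  move/(congr1 (fun v => pairing v (a' k))); rewrite !pairingZl.
  rewrite (pairing_root_coroot hD) => /mulIf; rewrite pnatr_eq0 => /(_ isT).
  by move/(mulfI gl0)/eqP; rewrite eqr_nat => /eqP/val_inj.
by have := leq_card _ h'I; rewrite card_ord ltnn.
Qed.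

Definition refl_index i j : I := projT1 (cid (refl_root hD i j)).

Lemma root_refl_index i j : a (refl_index i j) = refl i (a j).
Proof. by rewrite /refl_index; case: cid. Qed.

Lemma coroot_refl_index i j : a' (refl_index i j) = corefl i (a' j).
Proof. exact: coroot_refl (root_refl_index i j). Qed.

Lemma refl_indexK i : involutive (refl_index i).
Proof. by move=> j; apply: (root_inj hD); rewrite !root_refl_index reflK. Qed.

(** A reflection negates its own root. *)
Definition opp_index i : I := refl_index i i.

Lemma root_opp_index i : a (opp_index i) = - a i.
Proof. by rewrite root_refl_index refl_id. Qed.

Lemma coroot_opp_index i : a' (opp_index i) = - a' i.
Proof.
rewrite coroot_refl_index /corefl (pairing_root_coroot hD) scaler_nat mulr2n opprD.
by rewrite addNKr.
Qed.

Lemma opp_indexK : involutive opp_index.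
Proof. by move=> i; apply: (root_inj hD); rewrite !root_opp_index opprK. Qed.

Lemma refl_opp_index i j : refl_index i (opp_index j) = opp_index (refl_index i j).
Proof.
apply: (root_inj hD); rewrite !(root_refl_index, root_opp_index) /refl pairingNl.
by rewrite scaleNr -opprD.
Qed.

Lemma root_neq0 i : a i != 0.
Proof.
apply/eqP => a0; have := pairing_root_coroot hD i.
by rewrite a0 pairingC linear0.
Qed.

Local Notation pos i := `[< positive_root (i : I) >].

Lemma pos_opp_index i : pos (opp_index i) = ~~ pos i.
Proof.
apply/idP/idP => [/asboolP[c cE]|npi].
  apply/negP => /asboolP[b bE].
  have /(simple_free hD) cb0 :
      \sum_(j in simple D) ((b j)%:R + (c j)%:R) *: a j = 0.
    under eq_bigr => j _ do rewrite scalerDl !scaler_nat.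
    by rewrite big_split /= -bE -cE root_opp_index subrr.
  case/negP: (root_neq0 i); rewrite bE big1 // => j js.
  have /eqP := cb0 j js; rewrite -natrD pnatr_eq0 addn_eq0 => /andP[/eqP -> _].
  by rewrite mulr0n.
case: (simple_base hD i) => [|[j jp ij]]; first by move/asboolP; rewrite (negPf npi).
have -> : opp_index i = j by apply: (root_inj hD); rewrite root_opp_index ij opprK.
exact/asboolP.
Qed.

(** The reflection in [a i] negates [f j := pairing (a i) (a' j)], so the positive
    roots that it keeps positive contribute 0 to the sum of [f] that defines
    [rho]. On those that it makes negative (the inversions), [j] and the opposite
    of the reflected [j] have the same value, and only [i] itself is fixed by this
    involution, since the root system is reduced: its [f i = 2] becomes the
    summand 1, and every other orbit counts twice. *)
Lemma pairing_rho_pos i : pos i ->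
  exists S : {set I}, pairing (a i) (rho D) = 1 + \sum_(j in S) pairing (a i) (a' j).
Proof.
move=> ip; pose f j := pairing (a i) (a' j).
have fs j : f (refl_index i j) = - f j.
  by rewrite /f coroot_refl_index -pairing_refl refl_id pairingNl.
have fo j : f (opp_index j) = - f j by rewrite /f coroot_opp_index pairingNr.
pose s j := opp_index (refl_index i j).
have sK : involutive s by move=> j; rewrite /s refl_opp_index opp_indexK refl_indexK.
have fsj j : f (s j) = f j by rewrite /s fo fs opprK.
pose inv j := pos j && ~~ pos (refl_index i j).
have invs j : inv (s j) = inv j.
  by rewrite /inv /s refl_opp_index refl_indexK !pos_opp_index negbK andbC.
have invi : inv i by rewrite /inv ip pos_opp_index ip.
have si : s i = i by rewrite /s opp_indexK.
have fix_s j : inv j -> s j = j -> j = i.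
  move=> /andP[jp _] sj.
  have : a j = (pairing (a j) (a' i) / 2) *: a i.
    have := congr1 (fun l => a l) sj.
    rewrite root_opp_index root_refl_index /refl opprB => E.
    rewrite mulrC -scalerA -[X in _ *: X](subrK (a j)) E -mulr2n.
    by rewrite -scaler_nat scalerK.
  move/(root_reduced hD) => [/(root_inj hD) //|].
  rewrite -root_opp_index => /(root_inj hD) jo.
  by move: jp; rewrite jo pos_opp_index ip.
have [S SE] : exists S : {set I},
    \sum_(j | inv j && (j != i)) f j = (\sum_(j in S) f j) *+ 2.
  apply: (@sum_fixfree_involution _ _ _ s) => // j.
    by rewrite invs -{1}si (inj_eq (inv_inj sK)).
  by move=> /andP[jinv]; apply: contra => /eqP /(fix_s _ jinv) ->.
exists S; rewrite /rho pairingZr linear_sum /=.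
rewrite (bigID (fun j => pos (refl_index i j))) /=.
rewrite [X in X + _](_ : _ = 0).
  rewrite add0r -/(f _) (bigD1 i) //= -/(f _) -/(inv _).
  rewrite [X in _ + X](_ : _ = (\sum_(j in S) f j) *+ 2) //.
  have -> : f i = 2 by apply: pairing_root_coroot.
  by rewrite -[X in _ + X]mulr_natl mulrDr mulVf // mulKf.
apply/eqP; rewrite -eqNr -sumrN (reindex_inj (inv_inj (refl_indexK i))) /=.
apply/eqP; apply: eq_big => [j|j _]; first by rewrite refl_indexK andbC.
by rewrite -/(f _) fs opprK.
Qed.

End RootDatum.

(** * Divisibility of integers *)

Lemma int_parity (k : int) : (exists c, k = 2 * c) \/ (exists c, k = 2 * c + 1).
Proof.
have m0 : (0 <= k %% 2)%Z by rewrite modz_ge0.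
have m2 : (k %% 2 < 2)%Z by rewrite ltz_pmod.
have kE := divz_eq k 2.
have [m|m] : (k %% 2)%Z = 0 \/ (k %% 2)%Z = 1 by lia.
  by left; exists (k %/ 2)%Z; lia.
by right; exists (k %/ 2)%Z; lia.
Qed.

(** If [x] and [y] are odd and [N] divides [2 x] and [2 y], then the 2-adic
    valuation of [N] is at most 1, and the quotients of [2 x] and [2 y] by [N] are
    both even (for [N] odd) or both odd (for [N] even). *)
Lemma dvdz_sub_odd (N : nat) (u v : int) :
  (N %| (2 * u + 1) * 2)%Z -> (N %| (2 * v + 1) * 2)%Z ->
  (N %| (2 * u + 1) - (2 * v + 1))%Z.
Proof.
move=> /dvdzP[a aE] /dvdzP[b bE].
have [c cE] : exists c, a - b = 2 * c.
  have [[a1 a1E]|[a1 a1E]] := int_parity a; have [[b1 b1E]|[b1 b1E]] := int_parity b.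
  - by exists (a1 - b1); lia.
  - by have [[M ME]|[M ME]] := int_parity N; move: aE bE; rewrite a1E b1E ME; lia.
  - by have [[M ME]|[M ME]] := int_parity N; move: aE bE; rewrite a1E b1E ME; lia.
  - by exists (a1 - b1); lia.
apply/dvdzP; exists c; have : (a - b) * N = 2 * c * N by rewrite cE.
by rewrite mulrBl -aE -bE; lia.
Qed.

Lemma dvdn_mul_gcd (n q k : nat) :
  (0 < n)%N -> (n %| q * k)%N = (n %/ gcdn n q %| k)%N.
Proof.
move=> n0; have g0 : (0 < gcdn n q)%N by rewrite gcdn_gt0 n0.
have [nE qE] := (divnK (dvdn_gcdl n q), divnK (dvdn_gcdr n q)).
have cop : coprime (n %/ gcdn n q) (q %/ gcdn n q).
  by rewrite /coprime -(eqn_pmul2r g0) mul1n muln_gcdl nE qE.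
by rewrite -(Gauss_dvdr _ cop) -[in RHS](dvdn_pmul2r g0) nE mulnAC qE.
Qed.

(** * The lattices of the covering and the twisted fixed points *)

Section Covering.
Variables (r : nat) (D : root_data r) (Q : 'rV[rat]_r -> int) (n : nat).
Hypotheses (hD : is_root_datum D) (hss : semisimple D).
Hypotheses (hQ : is_quadratic_form (cocharlat D) Q) (hW : weyl_invariant D Q).
Hypothesis (n0 : (0 < n)%N).

Local Notation I := (root_index D).
Local Notation a i := (rootv (r := r) (i : I)).
Local Notation a' i := (corootv (r := r) (i : I)).
Local Notation Y := (cocharlat D).
Local Notation P := (dual_lattice (XQn_sc D Q n)).
Local Notation N i := (n_root Q n (i : I)).
Implicit Types i j : I.

Let Ysub : subgroup Y := cocharlat_subgroup hD.
Let Ya' i : Y (a' i) := coroot_cocharlat hD i.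

Lemma pairing_rho_int i : pairing (a i) (rho D) \is a Num.int.
Proof.
wlog ip : i / `[< positive_root i >].
  have [ip|] := boolP `[< positive_root i >]; first by apply.
  rewrite -(pos_opp_index hD) => /[swap] /[apply].
  by rewrite root_opp_index pairingNl rpredN.
have [S ->] := pairing_rho_pos hD hss ip.
by rewrite rpredD // rpred_sum // => j _; apply: pairing_root_int.
Qed.

(** All the terms but the first in [pairing_rho_pos] are even when [a i] is even on
    the cocharacter lattice; a negative root is the opposite of a positive one. *)
Lemma pairing_rho_odd i :
  (forall y, Y y -> exists c : int, pairing (a i) y = (2 * c)%:~R) ->
  exists c : int, pairing (a i) (rho D) = (2 * c + 1)%:~R.
Proof.
wlog ip : i / `[< positive_root i >].
  have [ip|] := boolP `[< positive_root i >]; first by apply.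
  rewrite -(pos_opp_index hD) => ip /(_ _ ip) H ev.
  have [|c] := H.
    move=> y /ev[c cE]; exists (- c).
    by rewrite root_opp_index pairingNl cE -mulrNz mulrN.
  rewrite root_opp_index pairingNl => /(canRL opprK) ->; exists (- c - 1).
  by rewrite -mulrNz; congr _%:~R; lia.
move=> ev; have [S ->] := pairing_rho_pos hD hss ip.
have [c cE] := choice (fun j => ev _ (Ya' j)).
exists (\sum_(j in S) c j); rewrite addrC mulr_sumr intrD rmorph_sum /=.
by congr (_ + _); apply: eq_bigr.
Qed.

Lemma polarC x y : polar Q x y = polar Q y x.
Proof. by rewrite /polar [x + y]addrC addrAC. Qed.

Lemma polar0 y : Y y -> polar Q 0 y = 0.
Proof.
move=> Yy; have := polarDl hQ Ysub.1 Ysub.1 Yy; rewrite addr0.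
by rewrite -{1}[polar Q 0 y]addr0 => /addrI <-.
Qed.

Lemma polarNl u y : Y u -> Y y -> polar Q (- u) y = - polar Q u y.
Proof.
move=> Yu Yy; apply/eqP; rewrite -addr_eq0 -(polarDl hQ) //.
  by rewrite addNr polar0.
exact: subgroupN.
Qed.

Lemma polarBl u v y : Y u -> Y v -> Y y ->
  polar Q (u - v) y = polar Q u y - polar Q v y.
Proof.
by move=> Yu Yv Yy; rewrite (polarDl hQ) ?polarNl //; apply: subgroupN.
Qed.

Lemma polarMz u k y : Y u -> Y y -> polar Q (u *~ k) y = k * polar Q u y.
Proof.
move=> Yu Yy; have nat m : polar Q (u *+ m) y = m%:Z * polar Q u y.
  elim: m => [|m IH]; first by rewrite mulr0n mul0r polar0.
  by rewrite mulrS (polarDl hQ) ?IH // ?intS ?mulrDl ?mul1r //; apply: subgroupMn.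
case: k => m; first exact: nat.
by rewrite NegzE mulrNz polarNl ?nat ?mulNr //; apply: subgroupMn.
Qed.

(** Invariance under the reflection [i], expanded at [y - k *: a' i], gives the
    identity multiplied by [k]. For [k = 0], apply it to [y + a' i], on which the
    root takes the value 2. *)
Lemma polar_coroot i y k :
  Y y -> pairing (a i) y = k%:~R -> polar Q (a' i) y = Q (a' i) * k.
Proof.
have nz z m : Y z -> pairing (a i) z = m%:~R -> m != 0 ->
    polar Q (a' i) z = Q (a' i) * m.
  move=> Yz zE m0; apply: (mulfI m0); apply: oppr_inj.
  rewrite -mulNr -polarMz // /polar (quadZ hQ) //.
  have -> : a' i *~ - m + z = corefl i z.
    by rewrite addrC mulrNz -scaler_int -zE.
  have -> : Q (corefl i z) = Q z by apply: (hW (weyl_refl i (weyl_id D))).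
  by rewrite addrAC subrr add0r sqrrN expr2; lia.
move=> Yy yE; have [k0|] := eqVneq k 0; last exact: nz.
have Ys : Y (y + a' i) by apply: subgroupD.
have self : pairing (a i) (a' i) = 2%:~R by apply: pairing_root_coroot.
have := nz _ 2 Ys; rewrite pairingDr yE k0 add0r => /(_ self isT).
by rewrite polarC (polarDl hQ) // [polar _ y _]polarC (nz (a' i) 2) // mulr0; lia.
Qed.

Lemma dvdz_n_root i k : (n %| Q (a' i) * k)%Z = (N i %| k)%Z.
Proof. by rewrite !dvdzE abszM dvdn_mul_gcd. Qed.

Lemma n_root_neq0 i : ((N i)%:R : rat) != 0.
Proof.
rewrite pnatr_eq0 -lt0n divn_gt0 ?gcdn_gt0 ?n0 //.
by apply: dvdn_leq => //; apply: dvdn_gcdl.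
Qed.

Lemma YQn_subgroup : subgroup (YQn D Q n).
Proof.
split; first by split=> [|y Yy]; [exact: Ysub.1|rewrite polar0 // dvdz0].
move=> u v [Yu hu] [Yv hv]; split; first exact: Ysub.2.
by move=> y Yy; rewrite polarBl // rpredB //; [exact: hu|exact: hv].
Qed.

Lemma YQn_lattice : is_lattice (YQn D Q n).
Proof.
apply: (@is_lattice_between _ Y _ n) => //; first exact: cocharlat_lattice.
- exact: YQn_subgroup.
- by move=> y [].
- exact: YQn_mul.
Qed.

Lemma YQn_pairing i y k :
  YQn D Q n y -> pairing (a i) y = k%:~R -> (N i %| k)%Z.
Proof.
by move=> [Yy yn] yE; rewrite -dvdz_n_root -(polar_coroot Yy yE) polarC yn.
Qed.

(** The condition is [N i %| m] unless the root takes only even values on the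
    cocharacter lattice, in which case it is the weaker [N i %| 2 * m]. *)
Lemma YQn_coroot i m :
  YQn D Q n (a' i *~ m) <->
  forall y k, Y y -> pairing (a i) y = k%:~R -> (N i %| m * k)%Z.
Proof.
have mE y k : Y y -> pairing (a i) y = k%:~R ->
    (n %| polar Q (a' i *~ m) y)%Z = (N i %| m * k)%Z.
  by move=> Yy yE; rewrite polarMz // (polar_coroot Yy yE) mulrCA dvdz_n_root.
split=> [[_ H] y k Yy yE|H]; first by rewrite -(mE _ _ Yy yE) H.
split=> [|y Yy]; first exact: subgroupMz.
have /intrP[k yE] := pairing_root_int hD i Yy.
by rewrite (mE _ _ Yy yE) (H _ _ Yy yE).
Qed.

Lemma dual_XQn_scP v :
  P v <-> forall i, exists2 k : int, pairing (a i) v = k%:~R & (N i %| k)%Z.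
Proof.
have E i : pairing (rootQn Q n i) v = (N i)%:R^-1 * pairing (a i) v.
  by rewrite pairingZl.
split=> [Pv i|H].
  have /Pv : XQn_sc D Q n (rootQn Q n i) by apply: zspan_gen.
  rewrite E => /intrP[k kE]; exists (k * N i); last exact: dvdz_mull.
  by rewrite intrM -kE mulrC mulVKf // n_root_neq0.
apply: dual_lattice_zspan => i; rewrite E; have [k -> /dvdzP[c ->]] := H i.
by rewrite intrM mulrC mulfK ?rpred_int // n_root_neq0.
Qed.

Lemma corefl_YQn i y : YQn D Q n y -> YQn D Q n (corefl i y).
Proof.
move=> hy; have [Yy yn] := hy; have /intrP[k yE] := pairing_root_int hD i Yy.
rewrite /corefl yE scaler_int; apply: YQn_subgroup.2 => //.
apply/YQn_coroot => z m _ _; apply: dvdz_mulr; exact: YQn_pairing yE.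
Qed.

(** The Weyl group being generated by the reflections, it suffices to look at
    these; the twisted reflection moves [y] by a multiple of a coroot. *)
Lemma fixedQnP C : fixedQn D Q n C <->
  exists y, [/\ Y y, C = coset (YQn D Q n) y &
    forall i, YQn D Q n (pairing (a i) (y - rho D) *: a' i)].
Proof.
have twE i y : twisted D (corefl i) y = y - pairing (a i) (y - rho D) *: a' i.
  by rewrite /twisted /corefl addrAC subrK.
split.
  move=> [[y Yy <-] fixC]; exists y; split=> // i.
  have yy : coset (YQn D Q n) y y.
    by exists 0; rewrite ?addr0 //; exact: YQn_subgroup.1.
  have : coset (YQn D Q n) y (twisted D (corefl i) y).
    by rewrite -[X in X _](fixC _ (weyl_refl i (weyl_id D))); exists y.
  move=> [l Yl]; rewrite twE => /addrI /(congr1 -%R); rewrite opprK => <-.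
  by apply: subgroupN => //; apply: YQn_subgroup.
move=> [y [Yy {C}-> fixy]]; split; first by exists y.
set L := YQn D Q n in fixy *; set C := coset L y.
have tw_sub i x : C x -> C (twisted D (corefl i) x).
  move=> [l Ll <-]; rewrite /twisted [y + l - _]addrAC coreflD addrAC.
  rewrite -/(twisted D (corefl i) y) twE -addrA.
  exists (corefl i l - pairing (a i) (y - rho D) *: a' i).
    by apply: YQn_subgroup.2; [exact: corefl_YQn|exact: fixy].
  by congr (_ + _); rewrite addrC.
have twK i x : twisted D (corefl i) (twisted D (corefl i) x) = x.
  by rewrite /twisted addrK coreflK // subrK.
move=> w; elim=> [|i {}w _ IH].
  by apply/seteqP; split=> x; [move=> [z Cz <-]|exists x => //];
    rewrite /twisted subrK.
have -> : [set twisted D (corefl i \o w) x | x in C] =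
    [set twisted D (corefl i) x | x in [set twisted D w x | x in C]].
  by rewrite image_comp; apply: eq_imagel => x _ /=; rewrite /twisted addrK.
rewrite IH; apply/seteqP; split=> x; first by move=> [z /tw_sub Cz <-].
by move=> /(tw_sub i) Cx; exists (twisted D (corefl i) x); rewrite ?twK.
Qed.

(** Put [k] and [m] for the values of [a i] at [y] and [z], and [q] for its value
    at [rho]. By hypothesis the multiples [k - q] and [m - q] of [a' i] lie in
    [YQn]. If [a i] takes an odd value on [Y], both numbers are
    divisible by [N i], and so is [k - m]. Otherwise only their doubles are, but
    [q] is odd, hence so are both numbers, and the difference is still divisible
    by [N i]. *)
Lemma fixed_sub y z : Y y -> Y z ->
  (forall i, YQn D Q n (pairing (a i) (y - rho D) *: a' i)) ->
  (forall i, YQn D Q n (pairing (a i) (z - rho D) *: a' i)) ->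
  P (y - z).
Proof.
move=> Yy Yz fy fz; apply/dual_XQn_scP => i.
have /intrP[q rhoE] := pairing_rho_int i.
have /intrP[k yE] := pairing_root_int hD i Yy.
have /intrP[m zE] := pairing_root_int hD i Yz.
exists (k - m); first by rewrite pairingBr yE zE intrB.
have := fy i; rewrite pairingBr yE rhoE -intrB scaler_int => /YQn_coroot Ny.
have := fz i; rewrite pairingBr zE rhoE -intrB scaler_int => /YQn_coroot Nz.
have self : pairing (a i) (a' i) = 2%:~R by apply: pairing_root_coroot.
have [[x [c [Yx xE]]]|ev] := pselect
  (exists x c, Y x /\ pairing (a i) x = (2 * c + 1)%:~R).
  have N1 u : (N i %| u * (2 * c + 1))%Z -> (N i %| u * 2)%Z -> (N i %| u)%Z.
    move=> h1 h2; have -> : u = u * (2 * c + 1) - u * 2 * c by lia.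
    by rewrite rpredB //; apply: dvdz_mulr.
  have -> : k - m = (k - q) - (m - q) by lia.
  by rewrite rpredB //; apply: N1;
    [exact: Ny xE|exact: Ny self|exact: Nz xE|exact: Nz self].
have {}ev x : Y x -> exists c : int, pairing (a i) x = (2 * c)%:~R.
  move=> Yx; have /intrP[l xE] := pairing_root_int hD i Yx.
  have [[c lE]|[c lE]] := int_parity l; first by exists c; rewrite xE lE.
  by case: ev; exists x, c; rewrite xE lE.
have [c] := pairing_rho_odd ev; rewrite rhoE => /intr_inj qE.
have [c1] := ev _ Yy; rewrite yE => /intr_inj kE.
have [c2] := ev _ Yz; rewrite zE => /intr_inj mE.
have -> : k - m = (2 * (c1 - c - 1) + 1) - (2 * (c2 - c - 1) + 1) by lia.
apply: dvdz_sub_odd.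
  by have := Ny _ _ (Ya' i) self; rewrite kE qE; congr (_ %| _ * _)%Z; lia.
by have := Nz _ _ (Ya' i) self; rewrite mE qE; congr (_ %| _ * _)%Z; lia.
Qed.

(** [pi1] of the dual group is the quotient of the dual of [YQn] by [XQn_sc], which
    has as many elements as the quotient of the dual lattices, by
    [card_quotient_dual]. *)
Lemma card_pi1_dual_group :
  finite_set (quotient P (YQn D Q n)) /\
  card_set (pi1 (dual_group D Q n)) = card_set (quotient P (YQn D Q n)).
Proof.
have := @card_quotient_dual _ (dual_lattice (YQn D Q n)) _ (@rootQn _ D Q n).
rewrite (dual_latticeK YQn_lattice); apply.
- exact/is_lattice_dual/YQn_lattice.
- move=> i y hy; rewrite pairingC pairingZl; have [Yy _] := hy.
  have /intrP[k yE] := pairing_root_int hD i Yy.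
  rewrite yE; have /dvdzP[c ->] := YQn_pairing hy yE.
  by rewrite intrM mulrC mulfK ?rpred_int // n_root_neq0.
- move=> v; have [c ->] := hss v; exists (fun i => c i * (N i)%:R).
  by apply: eq_bigr => i _; rewrite /rootQn scalerA mulfK // n_root_neq0.
- exact: finite_pi1.
Qed.

(** Subtracting one fixed point embeds the fixed points into the quotient of the
    dual of [XQn_sc] by [YQn]. *)
Lemma b_W_le_pi1 : (b_W D Q n <= card_set (pi1 (dual_group D Q n)))%N.
Proof.
have [fin ->] := card_pi1_dual_group.
have [E|/set0P[C0 /fixedQnP[y0 [Yy0 _ f0]]]] := eqVneq (fixedQn D Q n) set0.
  by rewrite /b_W E /card_set fset_set0 cardfs0.
rewrite /b_W -(card_set_image (image_set_inj (addrI (- y0))));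
  last exact: finite_fixedQn.
apply: card_set_sub => // _ [C /fixedQnP[y [Yy -> fy]] <-].
by rewrite coset_translate; exists (y - y0); [exact: fixed_sub|rewrite addrC].
Qed.

(** The difference [v] of two fixed points has [polar Q v (a' i)] divisible by [n]
    for all [i]; as the coroots generate the cocharacter lattice, [v] lies in
    [YQn]. *)
Lemma b_W_le1 : simply_connected D -> (b_W D Q n <= 1)%N.
Proof.
move=> sc.
have [E|/set0P[C0 /fixedQnP[y0 [Yy0 C0E f0]]]] := eqVneq (fixedQn D Q n) set0.
  by rewrite /b_W E /card_set fset_set0 cardfs0.
have -> : 1%N = card_set [set C0] by rewrite /card_set fset_set1 cardfs1.
apply: card_set_sub => // C /fixedQnP[y [Yy -> fy]] /=; rewrite C0E.
apply/(coset_eq YQn_subgroup).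
have Pv := fixed_sub Yy Yy0 fy f0; have Yv := Ysub.2 _ _ Yy Yy0.
split=> // y' Yy'; have : zspan (@corootv r D) y' by rewrite -sc.
set S := [set x | Y x /\ (n %| polar Q (y - y0) x)%Z].
have hS : subgroup S.
  split; first by split; [exact: Ysub.1|rewrite polarC polar0 ?dvdz0].
  move=> u v [Yu hu] [Yw hv]; split; first exact: Ysub.2.
  by rewrite polarC polarBl // ![polar Q _ (y - y0)]polarC rpredB.
have Sa' i : S (a' i).
  split=> //; have /dual_XQn_scP/(_ i)[k vE Nk] := Pv.
  by rewrite polarC (polar_coroot Yv vE) dvdz_n_root.
by move/(zspan_sub hS Sa') => [].
Qed.

(** The coset of [rho] is a fixed point, so the fixed points are the translates by
    [rho] of the classes in the dual of [XQn_sc]; this dual lies in the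
    cocharacter lattice as [XQn_sc] contains the character lattice. *)
Lemma b_W_eq_pi1 : Y (rho D) -> charlat D `<=` XQn_sc D Q n ->
  b_W D Q n = card_set (pi1 (dual_group D Q n)).
Proof.
move=> Yrho XX; have [fin ->] := card_pi1_dual_group.
have PY : P `<=` Y.
  by rewrite (cocharlat_dual hD) => v Pv x /XX; apply: Pv.
rewrite -(card_set_image (image_set_inj (addrI (rho D))) fin); congr card_set.
apply/seteqP; split=> C.
  move=> /fixedQnP[y [Yy -> fy]].
  have f0 i : YQn D Q n (pairing (a i) (rho D - rho D) *: a' i).
    by rewrite subrr linear0 scale0r; apply: YQn_subgroup.1.
  exists (coset (YQn D Q n) (y - rho D)).
    by exists (y - rho D) => //; apply: fixed_sub.
  by rewrite coset_translate addrC subrK.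
move=> [_ [v Pv <-] <-]; rewrite coset_translate; apply/fixedQnP.
exists (rho D + v); split=> // [|i]; first by apply: subgroupD => //; apply: PY.
rewrite [rho D + v]addrC addrK; have /dual_XQn_scP/(_ i)[k -> Nk] := Pv.
by rewrite scaler_int; apply/YQn_coroot => y m _ _; apply: dvdz_mulr.
Qed.

Lemma adjoint_rho : adjoint_type D -> Y (rho D).
Proof.
by rewrite (cocharlat_dual hD) => ->; apply: dual_lattice_zspan => i;
  apply: pairing_rho_int.
Qed.

Lemma adjoint_charlat_sub : adjoint_type D -> charlat D `<=` XQn_sc D Q n.
Proof.
move=> ->; apply: zspan_sub; first exact: zspan_subgroup.
move=> i; have -> : a i = rootQn Q n i *+ N i.
  by rewrite /rootQn -scaler_nat scalerA mulfV ?scale1r // n_root_neq0.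
by apply: subgroupMn; [exact: zspan_subgroup|exact: zspan_gen].
Qed.

End Covering.

Theorem theorem6p3 (r : nat) (D : root_data r) (Q : 'rV[rat]_r -> int)
    (hD : is_root_datum D) (hss : semisimple D)
    (hQ : is_quadratic_form (cocharlat D) Q) (hW : weyl_invariant D Q) :
  (forall n : nat, (0 < n)%N ->
     (b_W D Q n <= card_set (pi1 (dual_group D Q n)))%N) /\
  (simply_connected D -> forall n : nat, (0 < n)%N -> (b_W D Q n <= 1)%N) /\
  (cocharlat D (rho D) ->
     forall n : nat, (0 < n)%N -> charlat D `<=` XQn_sc D Q n ->
     b_W D Q n = card_set (pi1 (dual_group D Q n))) /\
  (adjoint_type D -> forall n : nat, (0 < n)%N ->
     b_W D Q n = card_set (pi1 (dual_group D Q n))).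
Proof.
split; first by move=> n n0; apply: b_W_le_pi1.
split; first by move=> sc n n0; apply: b_W_le1.
split; first by move=> Yrho n n0 XX; apply: b_W_eq_pi1.
move=> ad n n0; apply: b_W_eq_pi1 => //; first exact: adjoint_rho.
exact: adjoint_charlat_sub.
Qed.
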